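(* Let $i\in\{1,2\}$ and consider the sub-Riemannian space $(SU(1,1)\times\mathbb R,d_i)$. 1. Let $\varphi_0\in\mathbb R$, $\alpha_2\in(-1,1)$, $\beta\in\mathbb R$ be such that $w_i>0$, where $w_1=\sqrt{(\alpha_2+\beta)^2+\alpha_2^2-1}$, $w_2=\sqrt{\beta^2+\alpha_2^2-1}$ (so $w_i>0$ means that the expression under the root is positive). Then the $n$-th conjugate time $t^n_{\rm conj}$ along the geodesic $\tilde\gamma_i(t)=\tilde\gamma_i(\varphi_0,\alpha_2,\beta;t)$ has the form $$t^{2m-1}_{\rm conj}=\frac{2\pi m}{w_i},\qquad t^{2m}_{\rm conj}=\frac{2x_m}{w_i},\qquad m\in\mathbb N,$$ where $\{x_1,x_2,\dots\}$ are the ascending positive roots of the equation $\tan x=x$. 2. The first conjugate locus of $(SU(1,1)\times\mathbb R,d_i)$ is $$\mathrm{Conj}^1_i=\{(A,B,v)\in SU(1,1)\times\mathbb R\mid |A|=1,\ B=0,\ v\in\mathbb R\}.$$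
   Context: $SU(1,1)\times\mathbb R$ is the group of matrices $(A,B,v):=\begin{pmatrix}A&B&0\\ \overline B&\overline A&0\\0&0&e^v\end{pmatrix}$ with $A,B\in\mathbb C$, $|A|^2-|B|^2=1$, $v\in\mathbb R$; its Lie algebra has basis $E_1=\frac12(e_{12}+e_{21})$, $E_2=\frac i2(e_{12}-e_{21})$, $E_3=\frac i2(e_{11}-e_{22})$, $E_4=e_{33}$ ($e_{ij}$ with double indices are $3\times3$ matrix units). Put $e_1=E_1$, $e_3=E_2$, $e_4=-E_3$, and $e_2=E_4-E_3$ if $i=1$, $e_2=E_4$ if $i=2$. $d_i$ is the left-invariant sub-Riemannian metric defined by the left-invariant distribution with value $\mathrm{span}(e_1,e_2,e_3)$ at the unit $\mathrm{Id}$ and the inner product with orthonormal basis $e_1,e_2,e_3$. The normal geodesics from $\mathrm{Id}$ parametrized by arclength are $\tilde\gamma_i(\alpha_1,\alpha_2,\alpha_3,\beta;t)=\exp(t(\alpha_1e_1+\alpha_2e_2+\alpha_3e_3+\beta e_4))\exp(-t\beta e_4)$ with $(\alpha_1,\alpha_2,\alpha_3)\in\mathbb S^2$, $\beta\in\mathbb R$. If $\alpha_2\neq\pm1$ this geodesic is also denoted $\tilde\gamma_i(\varphi_0,\alpha_2,\beta;t)$, where $\alpha_1=\sqrt{1-\alpha_2^2}\cos\varphi_0$, $\alpha_3=-\sqrt{1-\alpha_2^2}\sin\varphi_0$. Let $C=\mathbb S^2\times\mathbb R$ and $\mathrm{Exp}_i:C\times\mathbb R_+\to SU(1,1)\times\mathbb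 R$, $\mathrm{Exp}_i(\lambda,t)=\tilde\gamma_i(\lambda;t)$ for $\lambda=(\alpha_1,\alpha_2,\alpha_3,\beta)$. A time $\hat t>0$ is a conjugate time along $\tilde\gamma_i(\lambda;\cdot)$ if the differential of $\mathrm{Exp}_i$ at $(\lambda,\hat t)$ is degenerate; the $n$-th conjugate time is the $n$-th one in ascending order. The first conjugate time $t^1_{\rm conj}$ is the infimum of all conjugate times $t>0$; if $0<t^1_{\rm conj}<\infty$, then $\tilde\gamma_i(t^1_{\rm conj})$ is the first conjugate point. $\mathrm{Conj}^1_i$ is the set of all first conjugate points along normal geodesics $\tilde\gamma_i$ starting at $\mathrm{Id}$. *)

(* Defs.v *)
From mathcomp Require Import all_boot all_order all_algebra.
From mathcomp Require Import complex.
From mathcomp Require Import all_classical all_reals all_analysis.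

Set Implicit Arguments.
Unset Strict Implicit.
Unset Printing Implicit Defensive.

Import Order.TTheory GRing.Theory Num.Theory.
Import numFieldNormedType.Exports.

Local Open Scope ring_scope.
Local Open Scope complex_scope.
Local Open Scope classical_set_scope.

Section Group.
Context {R : realType}.

Definition su11R_mx (A B : R[i]) (v : R) : 'M[R[i]]_3 :=
  \matrix_(j < 3, k < 3)
    nth 0 (nth [::] [:: [:: A;    B;    0];
                        [:: B^*;  A^*;  0];
                        [:: 0;    0;    (expR v)%:C]] j) k.

Definition SU11R : set 'M[R[i]]_3 :=
  [set M | exists A B v, `|A| ^+ 2 - `|B| ^+ 2 = 1 /\ M = su11R_mx A B v].

(* Row and column indices of delta_mx start from 0. *)
Definition E1 : 'M[R[i]]_3 := (1 / 2) *: (delta_mx 0 1 + delta_mx 1 0).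
Definition E2 : 'M[R[i]]_3 := ((0 +i* 1) / 2) *: (delta_mx 0 1 - delta_mx 1 0).
Definition E3 : 'M[R[i]]_3 := ((0 +i* 1) / 2) *: (delta_mx 0 0 - delta_mx 1 1).
Definition E4 : 'M[R[i]]_3 := delta_mx 2 2.

(* The index i of the metric d_i is meant to be 1 or 2. *)
Definition e1 : 'M[R[i]]_3 := E1.
Definition e2 (i : nat) : 'M[R[i]]_3 := if i == 1%N then E4 - E3 else E4.
Definition e3 : 'M[R[i]]_3 := E2.
Definition e4 : 'M[R[i]]_3 := - E3.

Definition expmx (X : 'M[R[i]]_3) : 'M[R[i]]_3 :=
  limn (series (fun k => (k`!%:R)^-1 *: X ^+ k)).

End Group.

Section Geodesics.
Context {R : realType}.

Definition sphere2 : set 'rV[R]_3 := [set a | \sum_(k < 3) a 0 k ^+ 2 = 1].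

(* (alpha_1, alpha_2, alpha_3) is the row a, with a 0 0 = alpha_1, and so on.
   On sphere2 this is the normal geodesic of d_i issuing from the identity;
   the formula makes sense, and is smooth, for all (a, b, t) in R^3 x R x R. *)
Definition geodesic (i : nat) (a : 'rV[R]_3) (b t : R) : 'M[R[i]]_3 :=
  expmx (t%:C *: ((a 0 0)%:C *: e1 + (a 0 1)%:C *: e2 i + (a 0 2)%:C *: e3
                  + b%:C *: e4))
  *m expmx (- (t * b)%:C *: e4).

(* The covector of the geodesic with coordinates (phi_0, alpha_2). *)
Definition polar (phi0 a2 : R) : 'rV[R]_3 :=
  \row_(k < 3) [:: Num.sqrt (1 - a2 ^+ 2) * cos phi0; a2;
                   - (Num.sqrt (1 - a2 ^+ 2) * sin phi0)]`_k.

Definition Exp (i : nat) (p : 'rV[R]_3 * R * R) : 'M[R[i]]_3 :=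
  geodesic i p.1.1 p.1.2 p.2.

(* The real normed space underlying the complex matrices. *)
Definition ReIm_mx (M : 'M[R[i]]_3) : 'M[R]_3 * 'M[R]_3 :=
  (map_mx (@complex.Re R) M, map_mx (@complex.Im R) M).

Definition tangent (a : 'rV[R]_3) (u : 'rV[R]_3 * R * R) : Prop :=
  \sum_(k < 3) u.1.1 0 k * a 0 k = 0.

(* S^2 x R x R_+ and SU(1,1) x R are embedded submanifolds of R^3 x R x R and of
   the real vector space of complex 3 x 3 matrices, so the differential of Exp_i
   at ((a, b), t) is the restriction of the differential of the ambient map to
   the tangent space of S^2 x R x R_+.  Both manifolds have dimension 4, so it
   is degenerate iff its kernel is nontrivial. *)
Definition degenerate (i : nat) (a : 'rV[R]_3) (b t : R) : Prop :=
  exists u : 'rV[R]_3 * R * R,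
    [/\ u != 0, tangent a u & 'd (ReIm_mx \o Exp i) (a, b, t) u = 0].

Definition conj_times (i : nat) (a : 'rV[R]_3) (b : R) : set R :=
  [set t | 0 < t /\ degenerate i a b t].

(* t is the n-th element of T in ascending order, counting from n = 1. *)
Definition nth_ascending (T : set R) (n : nat) (t : R) : Prop :=
  [/\ (0 < n)%N, T t & ([set s | T s /\ s < t] #= `I_n.-1)%card].

(* It is +oo if there are no conjugate times. *)
Definition first_conj_time (i : nat) (a : 'rV[R]_3) (b : R) : \bar R :=
  ereal_inf [set t%:E | t in conj_times i a b].

Definition first_conj_locus (i : nat) : set 'M[R[i]]_3 :=
  [set M | exists a b t, [/\ sphere2 a, first_conj_time i a b = t%:E, 0 < t
                          & M = geodesic i a b t]].

Definition wsq (i : nat) (a2 b : R) : R :=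
  if i == 1%N then (a2 + b) ^+ 2 + a2 ^+ 2 - 1 else b ^+ 2 + a2 ^+ 2 - 1.

(* Num.sqrt vanishes on negative numbers: 0 < w i a2 b iff 0 < wsq i a2 b. *)
Definition w (i : nat) (a2 b : R) : R := Num.sqrt (wsq i a2 b).

(* No spurious root at the zeros of cos, where tan takes the value 0. *)
Definition tan_roots : set R := [set x | 0 < x /\ tan x = x].

End Geodesics.

(* Main.v *)
From HB Require Import structures.
Require Import Defs.
From mathcomp Require Import all_boot all_order all_algebra.
From mathcomp Require Import complex.
From mathcomp Require Import all_classical all_reals all_analysis.
From mathcomp Require Import ring lra.

Set Implicit Arguments.
Unset Strict Implicit.
Unset Printing Implicit Defensive.

Import Order.TTheory GRing.Theory Num.Theory.
Import numFieldNormedType.Exports.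

Local Open Scope ring_scope.
Local Open Scope complex_scope.
Local Open Scope classical_set_scope.

(** The generator of a geodesic is the direct sum of a scalar block and of a
traceless 2 x 2 matrix N with N^2 = - (w/2)^2, where w^2 = [wsq]; so the
geodesic has the entries
  A = (p - i k s) exp(i th),  B = (b1 + i b2) s exp(- i th),  v = alpha_2 t
([geodesicE]), where th = beta t / 2, (b1, b2) = (alpha_1, alpha_3) t / 2,
2 k / t is alpha_2 + beta or beta, and p, s are the values at
z = b1^2 + b2^2 - k^2 = - (w t / 2)^2 of two entire functions [coshq] and
[sinhq], namely cosh and sinh(.)/(.) of the square root of z.  For w^2 > 0 and
x = w t / 2 they are cos x and sin x / x.

The kernel of the differential of Exp is found by removing the phases.  A
variation in the kernel fixes v, hence varies k and th equally, and the
equations collapse: the kernel is nontrivial exactly if alpha_1 = alpha_3 = 0,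
or [sinhq] vanishes at z, or its derivative does ([degenerate_iff]).

For alpha_2 = 1 or -1 every time is conjugate, and there is no first conjugate
point.  Otherwise, since [sinhq] and its derivative are positive for z >= 0,
conjugate times require w^2 > 0, and they are given by sin x = 0 or tan x = x.
On each interval between consecutive positive multiples of pi,
sin x - x cos x is monotone and changes sign, so it has exactly one root there,
and none in ]0, pi] ([tan_gap_lt], [tan_gap_root]): the conjugate times are
2 pi m / w and 2 x_m / w in turn ([conj_times_enum]).

The first conjugate point is hence reached at t = 2 pi / w.  There s = 0 and
p = -1, so B = 0 and A = - exp(i th); that every (A, 0, v) with |A| = 1 is
reached is [first_conj_locus_sup]. *)

(** * The entire functions cosh and sinh of a square root *)

Section EntireSeries.
Context {R : realType}.
Implicit Types (c : R^nat) (x z : R).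

Lemma is_cvg_pseries_le_exp c z :
  (forall k, `|c k| <= k`!%:R^-1) -> cvgn (pseries c z).
Proof.
move=> hc; apply: normed_cvg.
apply: (@series_le_cvg _ _ (exp_coeff `|z|)) => [n|n|n|].
- exact: normr_ge0.
- by rewrite /exp_coeff /= divr_ge0 // exprn_ge0.
- by rewrite /= normrM normrX /exp_coeff /= mulrC ler_wpM2l // exprn_ge0.
- exact: is_cvg_series_exp_coeff.
Qed.

(** [coshq z] is cosh of the square root of [z], and [sinhq z] is sinh of the
square root of [z] divided by that root.  Being power series in [z] they treat
the oscillating ([z < 0]), parabolic and hyperbolic geodesics uniformly and are
differentiable across [z = 0].  [dsinhq] is the derivative of [sinhq]. *)
Definition coshq_coeff : R^nat := fun k => (k.*2)`!%:R^-1.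
Definition sinhq_coeff : R^nat := fun k => (k.*2.+1)`!%:R^-1.

Definition coshq z : R := limn (pseries coshq_coeff z).
Definition sinhq z : R := limn (pseries sinhq_coeff z).
Definition dsinhq z : R := limn (pseries (pseries_diffs sinhq_coeff) z).

Lemma ler_invfact (m n : nat) : (m <= n)%N -> (n`!%:R : R)^-1 <= m`!%:R^-1.
Proof.
by move=> mn; rewrite lef_pV2 ?posrE ?ltr0n ?fact_gt0 // ler_nat leq_fact.
Qed.

Lemma pseries_diffs_coshq : pseries_diffs coshq_coeff = 2^-1 *: sinhq_coeff.
Proof.
apply/funext => k; rewrite /pseries_diffs /coshq_coeff /sinhq_coeff /=.
have -> : ((k.+1).*2)`!%:R = 2 * k.+1%:R * (k.*2.+1)`!%:R :> R.
  by rewrite -natrM mul2n -natrM -factS.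
have h1 : (k.+1%:R : R) != 0 by rewrite pnatr_eq0.
have h2 : (k.*2.+1`!%:R : R) != 0 by rewrite pnatr_eq0 -lt0n fact_gt0.
rewrite -[RHS]/(2^-1 * _); field.
by rewrite h2 nat1r h1.
Qed.

Lemma pseries_diffs_sinhq_coeff k :
  pseries_diffs sinhq_coeff k = k.+1%:R * (k.+1).*2.+1`!%:R^-1.
Proof. by []. Qed.

Lemma invfact_mul_le (m n a : nat) : (0 < a)%N -> (a * m`! <= n`!)%N ->
  `|(a%:R : R) * n`!%:R^-1| <= m`!%:R^-1.
Proof.
move=> a0 h; rewrite ger0_norm ?mulr_ge0 // ler_pdivrMr ?ltr0n ?fact_gt0 //.
by rewrite mulrC ler_pdivlMr ?ltr0n ?fact_gt0 // -natrM ler_nat.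
Qed.

Lemma cvg_coshq z : cvgn (pseries coshq_coeff z).
Proof.
apply: is_cvg_pseries_le_exp => k; rewrite ger0_norm ?invr_ge0 //.
by apply: ler_invfact; rewrite -addnn leq_addr.
Qed.

Lemma cvg_sinhq z : cvgn (pseries sinhq_coeff z).
Proof.
apply: is_cvg_pseries_le_exp => k; rewrite ger0_norm ?invr_ge0 //.
by apply: ler_invfact; rewrite -addnn -addnS leq_addr.
Qed.

Lemma cvg_dsinhq z : cvgn (pseries (pseries_diffs sinhq_coeff) z).
Proof.
apply: is_cvg_pseries_le_exp => k; apply: invfact_mul_le => //.
by rewrite -factS leq_fact // -addnn -addnS leq_addr.
Qed.

Lemma cvg_ddsinhq z :
  cvgn (pseries (pseries_diffs (pseries_diffs sinhq_coeff)) z).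
Proof.
apply: is_cvg_pseries_le_exp => k; rewrite {1}/pseries_diffs.
rewrite pseries_diffs_sinhq_coeff mulrA -natrM; apply: invfact_mul_le => //.
by rewrite (mulnC k.+1) -mulnA -!factS leq_fact // -addnn -addnS leq_addr.
Qed.

Lemma is_derive_sinhq z : is_derive z 1 sinhq (dsinhq z).
Proof.
apply: (@pseries_snd_diffs _ sinhq_coeff (`|z| + 1) z).
- exact: cvg_sinhq.
- exact: cvg_dsinhq.
- exact: cvg_ddsinhq.
- by rewrite [ltRHS]ger0_norm ?ltrDl // addr_ge0.
Qed.

Lemma pseries_scale (a : R) c z : pseries (a *: c) z = a *: pseries c z.
Proof.
apply/funext => n; rewrite -[RHS]/(a * _) mulr_sumr.
by apply: eq_bigr => k _; rewrite [RHS]mulrA.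
Qed.

Lemma pseries_diffsZ (a : R) c : pseries_diffs (a *: c) = a *: pseries_diffs c.
Proof.
apply/funext => k; rewrite /pseries_diffs.
by rewrite -[(a *: c) _]/(a * _) -[RHS]/(a * _) mulrCA.
Qed.

Lemma is_derive_coshq z : is_derive z 1 coshq (sinhq z / 2).
Proof.
have -> : sinhq z / 2 = limn (pseries (pseries_diffs coshq_coeff) z).
  rewrite pseries_diffs_coshq pseries_scale limZl_tmp; last exact: cvg_sinhq.
  by rewrite mulrC.
apply: (@pseries_snd_diffs _ coshq_coeff (`|z| + 1) z).
- exact: cvg_coshq.
- rewrite pseries_diffs_coshq pseries_scale; apply: is_cvgZl_tmp.
  exact: cvg_sinhq.
- rewrite pseries_diffs_coshq pseries_diffsZ pseries_scale.
  apply: is_cvgZl_tmp; exact: cvg_dsinhq.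
- by rewrite [ltRHS]ger0_norm ?ltrDl // addr_ge0.
Qed.

(** Coefficientwise this is 1/(2k)! = (1 + 2k)/(2k+1)!.  It gives the meaning of
the zeros of [dsinhq]: away from [z = 0], they are the points where [sinhq] and
[coshq] agree. *)
Lemma coshqE z : coshq z = sinhq z + 2 * z * dsinhq z.
Proof.
rewrite /coshq.
have -> : pseries coshq_coeff z = (pseries sinhq_coeff z +
    (2 * z) *: series (fun k => k%:R * sinhq_coeff k * z ^+ k.-1))%R.
  apply/funext => n; rewrite -[RHS]/(_ n + 2 * z * _ n) /pseries /series /=.
  rewrite mulr_sumr.
  rewrite -big_split; apply: eq_bigr => k _ /=.
  case: k => [|k].
    by rewrite /coshq_coeff /sinhq_coeff !mul0r mulr0 addr0.
  rewrite /coshq_coeff /sinhq_coeff [(k.+1.*2.+1)`!]factS natrM exprS /=.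
  have -> : (k.+1.*2.+1)%:R = 2 * k.+1%:R + 1 :> R.
    by rewrite -addn1 natrD -mul2n natrM.
  have : (0 : R) <= k.+1%:R by [].
  have : (k.+1.*2`!%:R : R) != 0 by rewrite pnatr_eq0 -lt0n fact_gt0.
  move: k.+1%:R (k.+1.*2`!%:R) => a f f0 a0.
  by field; rewrite f0 gt_eqF //; lra.
apply/cvg_lim => //; apply: cvgD; first exact: cvg_sinhq.
by apply: cvgZl_tmp; apply: pseries_diffs_equiv; exact: cvg_dsinhq.
Qed.

Lemma coshq_sqr x : coshq (- x ^+ 2) = cos x.
Proof.
have /(cvg_lim (@Rhausdorff R)) <- := @cvg_cos_coeff' R x.
congr (limn _); apply/funext => n; apply: eq_bigr => k _.
rewrite /coshq_coeff /cos_coeff' /= exprNn mulrC -exprM mul2n.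
by rewrite exprnP.
Qed.

Lemma sinhq_sqr x : x * sinhq (- x ^+ 2) = sin x.
Proof.
have /(cvg_lim (@Rhausdorff R)) <- := @cvg_sin_coeff' R x.
rewrite -[LHS]/(x *: sinhq _) -limZl_tmp; last exact: cvg_sinhq.
congr (limn _); apply/funext => n; rewrite [LHS]mulr_sumr.
apply: eq_bigr => k _.
rewrite /sinhq_coeff /sin_coeff' /= exprNn -exprM mul2n exprS -exprnP /=.
by ring.
Qed.

(** Applied to [sinhq] and [dsinhq], this is why there are no conjugate times
unless the geodesic oscillates. *)
Lemma limn_pseries_gt0 c z : 0 <= z -> (forall k, 0 <= c k) -> 0 < c 0%N ->
  cvgn (pseries c z) -> 0 < limn (pseries c z).
Proof.
move=> z0 c0 c00 cv; apply: (lt_le_trans c00).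
apply: limr_ge => //; near=> n.
have n0 : (0 < n)%N by near: n; exact: nbhs_infty_gt.
rewrite /pseries /series /= -(prednK n0) big_nat_recl // expr0 mulr1 lerDl.
by apply: sumr_ge0 => k _; rewrite mulr_ge0 // exprn_ge0.
Unshelve. all: by end_near. Qed.

Lemma sinhq_gt0 z : 0 <= z -> 0 < sinhq z.
Proof.
move=> z0; apply: limn_pseries_gt0 => //; last exact: cvg_sinhq.
  by move=> k; rewrite invr_ge0.
by rewrite invr_gt0.
Qed.

Lemma dsinhq_gt0 z : 0 <= z -> 0 < dsinhq z.
Proof.
move=> z0; apply: limn_pseries_gt0 => //; last exact: cvg_dsinhq.
  by move=> k; rewrite mulr_ge0 // invr_ge0.
by rewrite mulr_gt0 ?ltr01 // invr_gt0 ltr0n fact_gt0.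
Qed.

End EntireSeries.

(** * Exponential of a matrix with quadratic minimal polynomial *)

Section MatrixExponential.
Context {R : realType}.
Implicit Types (z v : R).

(** A positive element of [R[i]] is real, so the epsilons of the complex norm
are the real ones. *)
Lemma cvg_realC (u : R^nat) (l : R) :
  u @ \oo --> l -> (u n)%:C @[n --> \oo] --> (l%:C : (R[i] : numFieldType)).
Proof.
move=> ul; apply/(@cvgrPdist_lt _ ((R[i] : numFieldType)^o)) => e e0.
have eE : e = (complex.Re e)%:C.
  by apply/eqP; move: e0; rewrite ltcE eq_complex eqxx => /andP[/= /eqP ->].
have e0' : 0 < complex.Re e by move: e0; rewrite {1}eE ltcR.
move/cvgrPdist_lt: ul => /(_ _ e0') ul; near=> n.
rewrite eE -rmorphB /= normc_def /= expr0n /= addr0 sqrtr_sqr ltcR.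
by near: n.
Unshelve. all: by end_near. Qed.

Lemma cvg_half : half n @[n --> \oo] --> \oo.
Proof.
apply/cvgnyPge => A; near=> n.
by rewrite -(doubleK A) half_leq //; near: n; exact: nbhs_infty_ge.
Unshelve. all: by end_near. Qed.

Lemma cvg_uphalf : uphalf n @[n --> \oo] --> \oo.
Proof.
apply/cvgnyPge => A; near=> n.
rewrite -(doubleK A) uphalfE half_leq // ltnW //; near: n; exact: nbhs_infty_ge.
Unshelve. all: by end_near. Qed.

Definition even_pow z k : R := if odd k then 0 else z ^+ k./2.
Definition odd_pow z k : R := if odd k then z ^+ k./2 else 0.

Lemma cvg_even_pow z :
  series (fun k => k`!%:R^-1 * even_pow z k) @ \oo --> coshq z.
Proof.
have -> : series (fun k => k`!%:R^-1 * even_pow z k) =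
    (pseries coshq_coeff z) \o uphalf.
  apply/funext => n; rewrite /pseries /series /=.
  elim: n => [|n IH]; first by rewrite !big_nil.
  rewrite big_nat_recr //= IH uphalf_half /even_pow /=.
  case: (boolP (odd n)) => on; first by rewrite mulr0 addr0.
  rewrite add0n big_nat_recr //=; congr (_ + _ * _).
  by rewrite /coshq_coeff even_halfK.
apply: cvg_comp; first exact: cvg_uphalf.
exact: cvg_coshq.
Qed.

Lemma cvg_odd_pow z :
  series (fun k => k`!%:R^-1 * odd_pow z k) @ \oo --> sinhq z.
Proof.
have -> : series (fun k => k`!%:R^-1 * odd_pow z k) =
    (pseries sinhq_coeff z) \o half.
  apply/funext => n; rewrite /pseries /series /=.
  elim: n => [|n IH]; first by rewrite !big_nil.
  rewrite big_nat_recr //= IH uphalf_half /odd_pow /=.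
  case: (boolP (odd n)) => on; last by rewrite mulr0 addr0.
  rewrite add1n big_nat_recr //=; congr (_ + _ * _).
  by rewrite /sinhq_coeff odd_halfK // prednK // odd_gt0.
apply: cvg_comp; first exact: cvg_half.
exact: cvg_sinhq.
Qed.

Lemma cvg_expR v : series (fun k => k`!%:R^-1 * v ^+ k) @ \oo --> expR v.
Proof.
have := @is_cvg_series_exp_coeff R v; rewrite /expR.
by rewrite (_ : exp_coeff v = fun k => k`!%:R^-1 * v ^+ k) //;
  apply/funext => k; rewrite /exp_coeff /= mulrC.
Qed.

(** Powers alternate between [D] and [N] because [N * N = z D]: the even terms
of the exponential series sum to [coshq z] and the odd ones to [sinhq z].  The
idempotent [K] carries an independent block. *)
Lemma expmx_quadratic (D N K : 'M[R[i]]_3) z v :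
  D + K = 1 -> N * D = N -> N * N = z%:C *: D ->
  K * D = 0 -> K * N = 0 -> N * K = 0 -> K * K = K ->
  expmx (N + v%:C *: K) =
  (coshq z)%:C *: D + (sinhq z)%:C *: N + (expR v)%:C *: K.
Proof.
move=> DK ND NN KD KN NK KK.
have Xk k : (N + v%:C *: K) ^+ k = (even_pow z k)%:C *: D +
    (odd_pow z k)%:C *: N + (v ^+ k)%:C *: K.
  elim: k => [|k IH].
    by rewrite !expr0 /even_pow /odd_pow /= expr0 !scale1r scale0r addr0.
  rewrite exprS IH !mulrDr !mulrDl -!scalerAr -!scalerAl.
  rewrite ND NN KD KN NK KK !scaler0 !addr0 !add0r !scalerA.
  rewrite -!rmorphM /= [in LHS](addrC (_ *: N)).
  rewrite exprSr /even_pow /odd_pow /= uphalf_half.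
  by case: (odd k) => /=; rewrite ?mul0r ?exprSr.
have sep : hausdorff_space 'M[R[i] : numFieldType]_3 by exact: norm_hausdorff.
rewrite /expmx; refine (@cvg_lim _ sep _ _ _ _ _ _).
have -> : series (fun k => (k`!%:R)^-1 *: (N + v%:C *: K) ^+ k) =
  fun n => (series (fun k => k`!%:R^-1 * even_pow z k) n)%:C *: D +
   (series (fun k => k`!%:R^-1 * odd_pow z k) n)%:C *: N +
   (series (fun k => k`!%:R^-1 * v ^+ k) n)%:C *: K.
  apply/funext => n; rewrite /series /= !rmorph_sum /= !scaler_suml -!big_split.
  apply: eq_bigr => k _; rewrite /= Xk !scalerDr !scalerA.
  by rewrite !rmorphM !fmorphV !rmorph_nat.
by apply: cvgD; [apply: cvgD|]; apply: cvgZr_tmp; apply: cvg_realC;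
  [exact: cvg_even_pow|exact: cvg_odd_pow|exact: cvg_expR].
Qed.

End MatrixExponential.

(** * Geodesics in closed form *)

Section GeodesicFormula.
Context {R : realType}.
Implicit Types (c b r t z v : R) (i : nat) (a : 'rV[R]_3).

(** The element of su(1,1), bordered by zeros, whose square is
[b1 ^+ 2 + b2 ^+ 2 - c ^+ 2] times the identity of the upper 2 x 2 block. *)
Definition su11_mx c b1 b2 : 'M[R[i]]_3 :=
  \matrix_(j < 3, k < 3)
    nth 0 (nth [::] [:: [:: 0 -i* c;   b1 +i* b2; 0];
                        [:: b1 -i* b2; 0 +i* c;   0];
                        [:: 0;         0;         0]] j) k.

Ltac mx3 :=
  apply/matrixP => -[[|[|[|//]]] ?] -[[|[|[|//]]] ?];
  rewrite !mxE ?big_ord_recl ?big_ord0 /= ?mxE /=;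
  apply/eqP; rewrite eq_complex /=; apply/andP; split; apply/eqP.

Lemma expmx_su11 c b1 b2 v (z := b1 ^+ 2 + b2 ^+ 2 - c ^+ 2) :
  expmx (su11_mx c b1 b2 + v%:C *: delta_mx 2 2) =
  su11R_mx (coshq z -i* (c * sinhq z)) (b1 * sinhq z +i* (b2 * sinhq z)) v.
Proof.
by rewrite (@expmx_quadratic _ (delta_mx 0 0 + delta_mx 1 1) _ _ z) /z;
  mx3; ring.
Qed.

Lemma su11R_mxM_diag (A B A' : R[i]) v v' :
  su11R_mx A B v *m su11R_mx A' 0 v' = su11R_mx (A * A') (B * A'^*) (v + v').
Proof.
rewrite /su11R_mx expRD.
case: A B A' => [a1 a2] [b1 b2] [c1 c2]; move: (expR _) (expR _) => e e'.
by mx3; ring.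
Qed.

Lemma su11_mxZ r c b1 b2 :
  r%:C *: su11_mx c b1 b2 = su11_mx (r * c) (r * b1) (r * b2).
Proof. by mx3; ring. Qed.

Lemma su11_mxD c b1 b2 c' b1' b2' :
  su11_mx c b1 b2 + su11_mx c' b1' b2' = su11_mx (c + c') (b1 + b1') (b2 + b2').
Proof. by mx3; ring. Qed.

Lemma su11_mxN c b1 b2 : - su11_mx c b1 b2 = su11_mx (- c) (- b1) (- b2).
Proof. by mx3; ring. Qed.

Lemma inv2C : (2 : R[i])^-1 = (2^-1)%:C.
Proof. by rewrite fmorphV rmorph_nat. Qed.

Lemma E1E : E1 = su11_mx 0 2^-1 0.
Proof. by rewrite /E1 inv2C; mx3; ring. Qed.

Lemma E2E : E2 = su11_mx 0 0 2^-1.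
Proof. by rewrite /E2 inv2C; mx3; ring. Qed.

Lemma E3E : E3 = su11_mx (- 2^-1) 0 0.
Proof. by rewrite /E3 inv2C; mx3; ring. Qed.

Lemma e2E i :
  e2 i = su11_mx (if i == 1%N then 2^-1 else 0) 0 0 + delta_mx 2 2.
Proof.
rewrite /e2 E3E; case: (i == 1%N); last by rewrite /E4; mx3; ring.
by rewrite /E4 su11_mxN; mx3; ring.
Qed.

(** Minus the coefficient of E3 in the generator of the geodesic; the two
metrics differ only through it. *)
Definition rot_rate i a b : R := if i == 1%N then a 0 1 + b else b.
Definition kappa i a b t : R := rot_rate i a b * t / 2.
Definition theta b t : R := b * t / 2.

(** Minus the square of half the phase: on the unit sphere this is
[- (w t / 2) ^+ 2] whenever the geodesic oscillates. *)
Definition zeta i a b t : R :=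
  (a 0 0 * t / 2) ^+ 2 + (a 0 2 * t / 2) ^+ 2 - kappa i a b t ^+ 2.

Definition ReA i a b t : R :=
  coshq (zeta i a b t) * cos (theta b t)
  + kappa i a b t * sinhq (zeta i a b t) * sin (theta b t).
Definition ImA i a b t : R :=
  coshq (zeta i a b t) * sin (theta b t)
  - kappa i a b t * sinhq (zeta i a b t) * cos (theta b t).
Definition ReB i a b t : R := sinhq (zeta i a b t) *
  (a 0 0 * t / 2 * cos (theta b t) + a 0 2 * t / 2 * sin (theta b t)).
Definition ImB i a b t : R := sinhq (zeta i a b t) *
  (a 0 2 * t / 2 * cos (theta b t) - a 0 0 * t / 2 * sin (theta b t)).

Lemma geodesicE i a b t : geodesic i a b t =
  su11R_mx (ReA i a b t +i* ImA i a b t) (ReB i a b t +i* ImB i a b t)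
           (a 0 1 * t).
Proof.
rewrite /geodesic; set X := (X in expmx X *m _); set Y := (Y in _ *m expmx Y).
have -> : X =
  su11_mx (kappa i a b t) (a 0 0 * t / 2) (a 0 2 * t / 2) +
    (a 0 1 * t)%:C *: delta_mx 2 2.
  rewrite /X /kappa /rot_rate /e1 /e3 /e4 e2E E1E E2E E3E su11_mxN.
  rewrite [(a 0 1)%:C *: _]scalerDr !su11_mxZ.
  rewrite [X in X + su11_mx _ _ _ + _]addrA.
  rewrite ![_ + (a 0 1)%:C *: delta_mx 2 2 + su11_mx _ _ _]addrAC !su11_mxD.
  rewrite scalerDr su11_mxZ.
  rewrite scalerA -rmorphM [t * a 0 1]mulrC; congr (su11_mx _ _ _ + _).
  + by case: (i == 1%N); field.
  + by field.
  + by field.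
have -> : Y =
    su11_mx (- theta b t) 0 0 + 0%:C *: (delta_mx 2 2 : 'M[R[i]]_3).
  rewrite /Y /theta /e4 E3E su11_mxN -rmorphN su11_mxZ scale0r addr0.
  by congr su11_mx; field.
rewrite !expmx_su11 !mul0r expr0n /= addr0 sub0r sqrrN coshq_sqr.
rewrite mulNr sinhq_sqr su11R_mxM_diag addr0 -/(zeta i a b t).
by congr su11R_mx; apply/eqP; rewrite eq_complex /= /ReA /ImA /ReB /ImB;
  apply/andP; split; apply/eqP; ring.
Qed.

End GeodesicFormula.

(** * Directional derivatives *)

Section DirectionalDifferential.
Context {R : realType} {V : normedModType R}.
Implicit Types (x u : V).

(** Bundling differentiability with the value of the differential on one fixed
vector lets derivatives be composed as numbers, without handling linear maps. *)
Definition diff_along (W : normedModType R) (f : V -> W) x u (l : W) : Prop :=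
  differentiable f x /\ 'd f x u = l.

Section Vector.
Variable W : normedModType R.
Implicit Types f g : V -> W.

Lemma diff_along_cst (k : W) x u : diff_along (fun=> k) x u 0.
Proof. by split; [exact: differentiable_cst | rewrite diff_cst]. Qed.

Lemma diff_alongD f g x u l m : diff_along f x u l -> diff_along g x u m ->
  diff_along (fun y => f y + g y) x u (l + m).
Proof.
move=> [df <-] [dg <-]; split; first exact: differentiableD.
by rewrite (diffD df dg).
Qed.

Lemma diff_alongB f g x u l m : diff_along f x u l -> diff_along g x u m ->
  diff_along (fun y => f y - g y) x u (l - m).
Proof.
move=> [df <-] [dg <-]; split; first exact: differentiableB.
by rewrite (diffB df dg).
Qed.

Lemma diff_alongZl (f : V -> R) (w : W) x u (l : R) : diff_along f x u l ->
  diff_along (fun y => f y *: w) x u (l *: w).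
Proof.
by move=> [df <-]; split; [exact: differentiableZl | rewrite diffZl].
Qed.

End Vector.

Implicit Types f g : V -> R.

Lemma diff_alongM f g x u (l m : R) :
  diff_along f x u l -> diff_along g x u m ->
  diff_along (fun y => f y * g y) x u (f x * m + g x * l).
Proof.
move=> [df <-] [dg <-]; split; first exact: differentiableM.
by rewrite (diffM df dg).
Qed.

Lemma diff_along_comp (h : R -> R) f x u (l d : R) :
  is_derive (f x) 1 h d -> diff_along f x u l ->
  diff_along (fun y => h (f y)) x u (d * l).
Proof.
move=> [/derivable1_diffP dh hd] [df <-].
split; first exact: differentiable_comp.
by rewrite (diff_comp df dh) /= diff1E // derive1E hd [LHS]mulrC.
Qed.

(** Over an abstract codomain, so that the five coordinates of a geodesic can be
differentiated without unfolding the norm on pairs of matrices. *)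
Lemma diff_along_lincomb5 (W : normedModType R) (w1 w2 w3 w4 w5 : W)
    f1 f2 f3 f4 f5 x u (l1 l2 l3 l4 l5 : R) :
  diff_along f1 x u l1 -> diff_along f2 x u l2 -> diff_along f3 x u l3 ->
  diff_along f4 x u l4 -> diff_along f5 x u l5 ->
  diff_along (fun y => f1 y *: w1 + f2 y *: w2 + f3 y *: w3 + f4 y *: w4
                       + f5 y *: w5) x u
    (l1 *: w1 + l2 *: w2 + l3 *: w3 + l4 *: w4 + l5 *: w5).
Proof. by do 5 move=> ?; do 4?apply: diff_alongD; exact: diff_alongZl. Qed.

End DirectionalDifferential.

Section Coordinates.
Context {R : realType}.
Local Notation V := ('rV[R]_3 * R * R)%type.
Implicit Types x u : V.

Lemma differentiable_fst (U W : normedModType R) (x : U * W) :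
  differentiable fst x.
Proof. by apply: linear_differentiable => y; exact: cvg_fst. Qed.

Lemma diff_fst (U W : normedModType R) (x : U * W) :
  'd fst x = fst :> (U * W -> U).
Proof. by apply: diff_lin => y; exact: cvg_fst. Qed.

Lemma differentiable_snd (U W : normedModType R) (x : U * W) :
  differentiable snd x.
Proof. by apply: linear_differentiable => y; exact: cvg_snd. Qed.

Lemma diff_snd (U W : normedModType R) (x : U * W) :
  'd snd x = snd :> (U * W -> W).
Proof. by apply: diff_lin => y; exact: cvg_snd. Qed.

Lemma diff_along_time x u : diff_along (fun y : V => y.2) x u u.2.
Proof.
by split; [exact: differentiable_snd | rewrite diff_snd].
Qed.

Lemma diff_along_beta x u : diff_along (fun y : V => y.1.2) x u u.1.2.
Proof.
have h1 := @differentiable_fst ('rV[R]_3 * R)%type R x.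
have h2 := @differentiable_snd 'rV[R]_3 R x.1.
split; first exact: (differentiable_comp h1 h2).
by rewrite (diff_comp h1 h2) /= diff_fst diff_snd.
Qed.

Lemma diff_along_alpha (k : 'I_3) x u :
  diff_along (fun y : V => y.1.1 0 k) x u (u.1.1 0 k).
Proof.
have coordL : linear (fun N : 'rV[R]_3 => N 0 k) by move=> r M N; rewrite !mxE.
pose f : {linear 'rV[R]_3 -> R} := HB.pack (fun N : 'rV[R]_3 => N 0 k)
  (GRing.isLinear.Build _ _ _ _ _ coordL).
have fc : continuous f by exact: coord_continuous.
have h1 : differentiable (fst : V -> _) x by exact: differentiable_fst.
have h2 : differentiable (fst : 'rV[R]_3 * R -> _) x.1.
  exact: differentiable_fst.
have h12 : differentiable ((fst : 'rV[R]_3 * R -> _) \o (fst : V -> _)) x.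
  exact: differentiable_comp.
have h3 : differentiable f (x.1.1) by exact: linear_differentiable.
split; first exact: (differentiable_comp h12 h3).
rewrite -[LHS]/('d (f \o (fst \o fst)) x u).
by rewrite (diff_comp h12 h3) (diff_comp h1 h2) (diff_lin _ fc) /= !diff_fst.
Qed.

End Coordinates.

(** * Differential of the exponential map *)

Section KernelEquations.
Context {R : realType}.
Variables (k b1 b2 dk db1 db2 dth : R).

Let z := b1 ^+ 2 + b2 ^+ 2 - k ^+ 2.
Let dz := 2 * (b1 * db1 + b2 * db2 - k * dk).

(** Derivatives of A = (coshq z - i k sinhq z) exp(i th) and
B = (b1 + i b2) sinhq z exp(- i th), turned back by the phases exp(- i th) and
exp(i th).  [kerA_im] has the sign opposite to the imaginary part. *)
Definition kerA_re := sinhq z / 2 * dz + k * sinhq z * dth.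
Definition kerA_im := sinhq z * dk + k * (dsinhq z * dz) - coshq z * dth.
Definition kerB_re := sinhq z * db1 + b1 * (dsinhq z * dz) + sinhq z * b2 * dth.
Definition kerB_im := sinhq z * db2 + b2 * (dsinhq z * dz) - sinhq z * b1 * dth.

(** A variation that keeps v fixed varies [k] and [th] equally.  Then the terms
in [k] cancel in [kerA_re]; in [kerA_im], [coshqE] moreover cancels [sinhq] and
leaves the factor [dsinhq z]. *)
Lemma kerA_re_rigid : dk = dth -> kerA_re = sinhq z * (b1 * db1 + b2 * db2).
Proof. by move=> e; rewrite /kerA_re /dz e; field. Qed.

Lemma kerA_im_rigid : dk = dth -> kerA_im =
  2 * dsinhq z * (k * (b1 * db1 + b2 * db2) - (b1 ^+ 2 + b2 ^+ 2) * dth).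
Proof. by move=> e; rewrite /kerA_im coshqE /dz e /z; ring. Qed.

End KernelEquations.

Section RotatedExponential.
Context {R : realType} {V : normedModType R}.
Variables (k th b1 b2 : V -> R) (x u : V) (dk dth db1 db2 : R).
Hypotheses (hk : diff_along k x u dk) (hth : diff_along th x u dth).
Hypotheses (hb1 : diff_along b1 x u db1) (hb2 : diff_along b2 x u db2).

Let z y := b1 y ^+ 2 + b2 y ^+ 2 - k y ^+ 2.
Let dz := 2 * (b1 x * db1 + b2 x * db2 - k x * dk).
Let p := coshq (z x).
Let s := sinhq (z x).
Let s' := dsinhq (z x).

Let hz : diff_along z x u dz.
Proof.
have := diff_alongB (diff_alongD (diff_alongM hb1 hb1) (diff_alongM hb2 hb2))
  (diff_alongM hk hk).
by congr diff_along; rewrite /dz; ring.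
Qed.

Let hp : diff_along (fun y => coshq (z y)) x u (s / 2 * dz).
Proof. exact: diff_along_comp (is_derive_coshq _) hz. Qed.

Let hs : diff_along (fun y => sinhq (z y)) x u (s' * dz).
Proof. exact: diff_along_comp (is_derive_sinhq _) hz. Qed.

Let hcos : diff_along (fun y => cos (th y)) x u (- sin (th x) * dth).
Proof. exact: diff_along_comp (is_derive_cos _) hth. Qed.

Let hsin : diff_along (fun y => sin (th y)) x u (cos (th x) * dth).
Proof. exact: diff_along_comp (is_derive_sin _) hth. Qed.

Let pA := kerA_re (k x) (b1 x) (b2 x) dk db1 db2 dth.
Let qA := kerA_im (k x) (b1 x) (b2 x) dk db1 db2 dth.
Let pB := kerB_re (k x) (b1 x) (b2 x) dk db1 db2 dth.
Let qB := kerB_im (k x) (b1 x) (b2 x) dk db1 db2 dth.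

Lemma diff_along_ReA :
  diff_along
    (fun y => coshq (z y) * cos (th y) + k y * sinhq (z y) * sin (th y))
    x u (cos (th x) * pA + sin (th x) * qA).
Proof.
have := diff_alongD (diff_alongM hp hcos)
  (diff_alongM (diff_alongM hk hs) hsin).
by congr diff_along; rewrite /pA /qA /kerA_re /kerA_im /p /s /s' /dz /z; ring.
Qed.

Lemma diff_along_ImA :
  diff_along
    (fun y => coshq (z y) * sin (th y) - k y * sinhq (z y) * cos (th y))
    x u (sin (th x) * pA - cos (th x) * qA).
Proof.
have := diff_alongB (diff_alongM hp hsin)
  (diff_alongM (diff_alongM hk hs) hcos).
by congr diff_along; rewrite /pA /qA /kerA_re /kerA_im /p /s /s' /dz /z; ring.
Qed.

Lemma diff_along_ReB :
  diff_along (fun y => sinhq (z y) * (b1 y * cos (th y) + b2 y * sin (th y)))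
    x u (cos (th x) * pB + sin (th x) * qB).
Proof.
have := diff_alongM hs
  (diff_alongD (diff_alongM hb1 hcos) (diff_alongM hb2 hsin)).
by congr diff_along; rewrite /pB /qB /kerB_re /kerB_im /s /s' /dz /z; ring.
Qed.

Lemma diff_along_ImB :
  diff_along (fun y => sinhq (z y) * (b2 y * cos (th y) - b1 y * sin (th y)))
    x u (cos (th x) * qB - sin (th x) * pB).
Proof.
have := diff_alongM hs
  (diff_alongB (diff_alongM hb2 hcos) (diff_alongM hb1 hsin)).
by congr diff_along; rewrite /pB /qB /kerB_re /kerB_im /s /s' /dz /z; ring.
Qed.

End RotatedExponential.

Section LinearCombination.
Context {R : realType}.
Local Notation V := ('rV[R]_3 * R * R)%type.
Implicit Types (i : nat) (a : 'rV[R]_3) (b t : R) (x u : V).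

(** A rotation is injective: this removes exp(i th) and exp(- i th). *)
Lemma rotation_eq0 (c s p q : R) : c ^+ 2 + s ^+ 2 = 1 ->
  (c * p + s * q = 0 /\ s * p - c * q = 0) <-> (p = 0 /\ q = 0).
Proof.
move=> cs; split=> [[h1 h2]|[-> ->]]; last by rewrite !mulr0 addr0 subr0.
split.
  have -> : p = c * (c * p + s * q) + s * (s * p - c * q).
    by rewrite -[LHS]mul1r -cs; ring.
  by rewrite h1 h2 !mulr0 addr0.
have -> : q = s * (c * p + s * q) - c * (s * p - c * q).
  by rewrite -[LHS]mul1r -cs; ring.
by rewrite h1 h2 !mulr0 subr0.
Qed.

Lemma sum3 (f : 'I_3 -> R) : \sum_(k < 3) f k = f 0 + f 1 + f 2.
Proof.
rewrite !big_ord_recr big_ord0 /= add0r.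
by congr (f _ + f _ + f _); apply: val_inj.
Qed.

Definition basisReA : 'M[R]_3 * 'M[R]_3 := (delta_mx 0 0 + delta_mx 1 1, 0).
Definition basisImA : 'M[R]_3 * 'M[R]_3 := (0, delta_mx 0 0 - delta_mx 1 1).
Definition basisReB : 'M[R]_3 * 'M[R]_3 := (delta_mx 0 1 + delta_mx 1 0, 0).
Definition basisImB : 'M[R]_3 * 'M[R]_3 := (0, delta_mx 0 1 - delta_mx 1 0).
Definition basisV : 'M[R]_3 * 'M[R]_3 := (delta_mx 2 2, 0).

(** [su11R_mx A B v] is linear in Re A, Im A, Re B, Im B and exp v; these are
the five directions. *)
Definition coord_comb (l1 l2 l3 l4 l5 : R) : 'M[R]_3 * 'M[R]_3 :=
  l1 *: basisReA + l2 *: basisImA + l3 *: basisReB + l4 *: basisImB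
  + l5 *: basisV.

Lemma coord_combE l1 l2 l3 l4 l5 : coord_comb l1 l2 l3 l4 l5 =
  (l1 *: (delta_mx 0 0 + delta_mx 1 1) + l3 *: (delta_mx 0 1 + delta_mx 1 0)
    + l5 *: delta_mx 2 2,
   l2 *: (delta_mx 0 0 - delta_mx 1 1) + l4 *: (delta_mx 0 1 - delta_mx 1 0)).
Proof.
by rewrite /coord_comb; apply/pair_equal_spec; split;
  rewrite /= !scaler0 ?addr0 ?add0r.
Qed.

Lemma coord_comb_eq0 l1 l2 l3 l4 l5 : coord_comb l1 l2 l3 l4 l5 = 0 <->
  [/\ l1 = 0, l2 = 0, l3 = 0, l4 = 0 & l5 = 0].
Proof.
split=> [|[-> -> -> -> ->]]; last first.
  by rewrite coord_combE !scale0r !addr0.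
rewrite coord_combE => -[/matrixP hr /matrixP hi].
have := hr 0 0; have := hr 0 1; have := hr 2 2; have := hi 0 0; have := hi 0 1.
rewrite !mxE /= !(oppr0, mulr0, mulr1, addr0, add0r).
by move=> -> -> -> -> ->.
Qed.

Lemma ReIm_su11R_mx (a1 a2 b1 b2 v : R) :
  ReIm_mx (su11R_mx (a1 +i* a2) (b1 +i* b2) v) =
  coord_comb a1 a2 b1 b2 (expR v).
Proof.
rewrite coord_combE /ReIm_mx; congr (_, _);
apply/matrixP => -[[|[|[|//]]] ?] -[[|[|[|//]]] ?];
  by rewrite !mxE /=; ring.
Qed.

Lemma diff_coord_comb (f1 f2 f3 f4 f5 : V -> R) x u (l1 l2 l3 l4 l5 : R) :
  diff_along f1 x u l1 -> diff_along f2 x u l2 -> diff_along f3 x u l3 ->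
  diff_along f4 x u l4 -> diff_along f5 x u l5 ->
  'd (fun y => coord_comb (f1 y) (f2 y) (f3 y) (f4 y) (f5 y)) x u =
  coord_comb l1 l2 l3 l4 l5.
Proof.
move=> h1 h2 h3 h4 h5.
exact: (diff_along_lincomb5 basisReA basisImA basisReB basisImB basisV
  h1 h2 h3 h4 h5).2.
Qed.

End LinearCombination.

(** * Conjugate times as zeros *)

Section Degeneracy.
Context {R : realType}.
Local Notation V := ('rV[R]_3 * R * R)%type.
Implicit Types (i : nat) (a : 'rV[R]_3) (b t : R) (x u : V).

Section Kernel.
Variables (i : nat) (a : 'rV[R]_3) (b t : R) (u : V).

Let k := kappa i a b t.
Let b1 := a 0 0 * t / 2.
Let b2 := a 0 2 * t / 2.
Let dth := (u.1.2 * t + b * u.2) / 2.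
Let dv := u.1.1 0 1 * t + a 0 1 * u.2.
Let db1 := (u.1.1 0 0 * t + a 0 0 * u.2) / 2.
Let db2 := (u.1.1 0 2 * t + a 0 2 * u.2) / 2.

Definition kernel_equations : Prop :=
  [/\ dv = 0,
    kerA_re k b1 b2 dth db1 db2 dth = 0 /\ kerA_im k b1 b2 dth db1 db2 dth = 0 &
    kerB_re k b1 b2 dth db1 db2 dth = 0 /\ kerB_im k b1 b2 dth db1 db2 dth = 0].

(** The derivative of v gives [dv = 0] first; then [kappa] and [theta] vary
equally, because they differ by 0 or by v/2. *)
Lemma diff_Exp_eq0 :
  'd (ReIm_mx \o Exp i) (a, b, t) u = 0 <-> kernel_equations.
Proof.
pose x : V := (a, b, t).
have hal j := diff_along_alpha j x u.
have ht := diff_along_time x u.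
have hb := diff_along_beta x u.
have h2 := diff_along_cst (2^-1 : R) x u.
have hth : diff_along (fun y : V => theta y.1.2 y.2) x u dth.
  have := diff_alongM (diff_alongM hb ht) h2.
  by congr diff_along; rewrite /dth /=; ring.
have hb1 : diff_along (fun y : V => y.1.1 0 0 * y.2 / 2) x u db1.
  have := diff_alongM (diff_alongM (hal 0) ht) h2.
  by congr diff_along; rewrite /db1 /=; ring.
have hb2 : diff_along (fun y : V => y.1.1 0 2 * y.2 / 2) x u db2.
  have := diff_alongM (diff_alongM (hal 2) ht) h2.
  by congr diff_along; rewrite /db2 /=; ring.
have hv : diff_along (fun y : V => y.1.1 0 1 * y.2) x u dv.
  have := diff_alongM (hal 1) ht.
  by congr diff_along; rewrite /dv /=; ring.
pose dk := dth + (if i == 1%N then dv / 2 else 0).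
have hk : diff_along (fun y : V => kappa i y.1.1 y.1.2 y.2) x u dk.
  rewrite /dk /kappa /rot_rate; case: (i == 1%N); last by rewrite addr0.
  have := diff_alongM (diff_alongM (diff_alongD (hal 1) hb) ht) h2.
  by congr diff_along; rewrite /dth /dv /=; field.
have hA1 := diff_along_ReA hk hth hb1 hb2.
have hA2 := diff_along_ImA hk hth hb1 hb2.
have hB1 := diff_along_ReB hk hth hb1 hb2.
have hB2 := diff_along_ImB hk hth hb1 hb2.
have hE := diff_along_comp (is_derive_expR _) hv.
have -> : ReIm_mx \o Exp i = fun y : V =>
    coord_comb (ReA i y.1.1 y.1.2 y.2) (ImA i y.1.1 y.1.2 y.2)
     (ReB i y.1.1 y.1.2 y.2) (ImB i y.1.1 y.1.2 y.2) (expR (y.1.1 0 1 * y.2)).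
  by apply/funext => y; rewrite /= /Exp geodesicE ReIm_su11R_mx.
rewrite (diff_coord_comb hA1 hA2 hB1 hB2 hE) coord_comb_eq0 /kernel_equations.
have cs := cos2Dsin2 (theta b t).
have dkE : dv = 0 -> dk = dth by rewrite /dk => ->; rewrite mul0r if_same addr0.
have opp0 (p q : R) : p - q = 0 <-> q - p = 0.
  rewrite -[q - p]opprB.
  by split=> [->|/eqP]; rewrite ?oppr0 // oppr_eq0 => /eqP.
split=> [[hP hK hL1 /opp0 hL2 /eqP]|[v0 hA hB]].
- rewrite mulf_eq0 gt_eqF ?expR_gt0 //= => /eqP v0.
  have /(rotation_eq0 _ _ cs) := conj hP hK.
  have /(rotation_eq0 _ _ cs) := conj hL1 hL2.
  by rewrite dkE.
- have /(rotation_eq0 _ _ cs) [hP hK] := hA.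
  have /(rotation_eq0 _ _ cs) [hL1 /opp0 hL2] := hB.
  by rewrite dkE // v0 mulr0; split.
Qed.

End Kernel.

(** Each alternative provides an explicit kernel vector.  Conversely, let the
three quantities be nonzero.  The equation [kerA_re = 0], the constancy of v and
tangency to the sphere yield [dt = 0]; then [kerA_im = 0] says that
[dsinhq z * (alpha_1^2 + alpha_3^2) * dth = 0], so [th] is stationary, and the
equations for B leave no variation of alpha_1 and alpha_3. *)
Lemma degenerate_iff i a b t : sphere2 a -> 0 < t ->
  degenerate i a b t <-> [\/ a 0 0 ^+ 2 + a 0 2 ^+ 2 = 0,
    sinhq (zeta i a b t) = 0 | dsinhq (zeta i a b t) = 0].
Proof.
rewrite /sphere2 /= sum3 => sph t0; rewrite /zeta.
set k := kappa i a b t; set r2 := a 0 0 ^+ 2 + a 0 2 ^+ 2.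
have deg (u : V) : u != 0 ->
    u.1.1 0 0 * a 0 0 + u.1.1 0 1 * a 0 1 + u.1.1 0 2 * a 0 2 = 0 ->
    kernel_equations i a b t u -> degenerate i a b t.
  move=> u0 tg ku; exists u; split=> //; first by rewrite /tangent sum3.
  exact/diff_Exp_eq0.
split; last first.
- (* Here the geodesic is exp(t e2) or exp(- t e2), whatever b. *)
  have axis : r2 = 0 -> degenerate i a b t.
    move=> h; have [a0 a2] : a 0 0 = 0 /\ a 0 2 = 0.
      by split; apply/eqP; rewrite -sqrf_eq0; apply/eqP; move: h;
        rewrite /r2; nra.
    apply: (deg (0, 1, 0)).
    + by rewrite !xpair_eqE oner_eq0 andbF.
    + by rewrite /= !mxE; ring.
    + rewrite /kernel_equations kerA_re_rigid // kerA_im_rigid //.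
      rewrite /kerB_re /kerB_im /= !mxE a0 a2.
      by split; [ring | split; ring | split; ring].
  case=> [//|h|h].
  + have [/axis//|r0] := eqVneq r2 0.
    (* B = 0 here, so rotating the covector about the axis moves nothing. *)
    apply: (deg (\row_j [:: - a 0 2; 0; a 0 0]`_j, 0, 0)).
    * apply: contra_neq r0 => -[/rowP e]; have := e 0; have := e 2.
      by rewrite /r2 !mxE /= => -> /eqP; rewrite oppr_eq0 => /eqP ->; ring.
    * by rewrite /= !mxE /=; ring.
    * rewrite /kernel_equations kerA_re_rigid // kerA_im_rigid //.
      rewrite /kerB_re /kerB_im /= !mxE /= -/k h.
      by split; [ring | split; field | split; field].
  + (* Changing b by 1 turns B by - t/2; the rotation of the covector by t/2
       compensates it. *)
    pose da : 'rV[R]_3 := \row_j [:: - (a 0 2 * t / 2); 0; a 0 0 * t / 2]`_j.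
    apply: (deg (da, 1, 0)).
    * by rewrite !xpair_eqE oner_eq0 andbF.
    * by rewrite /= !mxE /=; ring.
    * rewrite /kernel_equations kerA_re_rigid // kerA_im_rigid //.
      rewrite /kerB_re /kerB_im /= !mxE /= -/k h.
      by split; [ring | split; field | split; field].
move=> [u [u0]]; rewrite /tangent sum3 => tg /diff_Exp_eq0.
rewrite /kernel_equations kerA_re_rigid // kerA_im_rigid // -/k.
have [/eqP|r0] := boolP (r2 == 0); first by constructor 1.
set z := _ + _ - _.
have [/eqP|s0] := boolP (sinhq z == 0); first by constructor 2.
have [/eqP|d0] := boolP (dsinhq z == 0); first by constructor 3.
case: u u0 tg => [[da db] dt] /= u0 tg [dv [hP hK] [hB1 hB2]]; case/negP: u0.
have tn0 : t != 0 by rewrite gt_eqF.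
(* S is half the variation of b1^2 + b2^2. *)
set S := a 0 0 * t / 2 * ((da 0 0 * t + a 0 0 * dt) / 2) +
  a 0 2 * t / 2 * ((da 0 2 * t + a 0 2 * dt) / 2) in hP hK.
have S0 : S = 0 by apply: (mulfI s0); rewrite hP mulr0.
have dt0 : dt = 0.
  apply: (mulfI (mulf_neq0 tn0 tn0)); rewrite mulr0.
  have -> : t * t * dt = 4 * t * S -
      t ^+ 3 * (da 0 0 * a 0 0 + da 0 1 * a 0 1 + da 0 2 * a 0 2) +
      t ^+ 2 * a 0 1 * (da 0 1 * t + a 0 1 * dt).
    transitivity (t * t * dt * (a 0 0 ^+ 2 + a 0 1 ^+ 2 + a 0 2 ^+ 2)).
      by rewrite sph mulr1.
    by rewrite /S; field.
  by rewrite S0 tg dv; ring.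
have da1 : da 0 1 = 0 by apply: (mulIf tn0); rewrite mul0r -dv dt0; ring.
have dth0 : (db * t + b * dt) / 2 = 0.
  have h : 2 * dsinhq z * (r2 * (t * t) / 4) != 0.
    by rewrite !mulf_neq0 // invr_neq0.
  by apply: (mulfI h); rewrite mulr0 -[RHS]oppr0 -[in RHS]hK S0 /r2; field.
have db0 : db = 0.
  by apply: (mulIf tn0); rewrite mul0r -[RHS](mul0r 2) -dth0 dt0; field.
have sum0 : a 0 0 * t / 2 * ((da 0 0 * t + a 0 0 * dt) / 2) +
   a 0 2 * t / 2 * ((da 0 2 * t + a 0 2 * dt) / 2) = 0 := S0.
move: hB1 hB2; rewrite /kerB_re /kerB_im -/z sum0 dth0.
rewrite !mulr0 subr0 addr0 !mulr0 addr0 subr0 addr0 => /eqP.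
rewrite mulf_eq0 (negPf s0) /= => /eqP e1 /eqP.
rewrite mulf_eq0 (negPf s0) /= => /eqP e2.
have half0 (p q : R) : (p * t + q * dt) / 2 = 0 -> p = 0.
  rewrite dt0 => e; apply: (mulIf tn0).
  by rewrite mul0r -[RHS](mul0r 2) -e; field.
have da0 : da = 0.
  apply/rowP => -[[|[|[|//]]] hj]; rewrite mxE.
  - by rewrite -(half0 _ _ e1); congr (da _ _); apply: val_inj.
  - by rewrite -da1; congr (da _ _); apply: val_inj.
  - by rewrite -(half0 _ _ e2); congr (da _ _); apply: val_inj.
by rewrite da0 db0 dt0.
Qed.

End Degeneracy.

(** * Positive solutions of sin x = 0 and of tan x = x *)

Section TangentRoots.
Context {R : realType}.
Implicit Types (c x y : R) (m : nat).

(** For [c] a multiple of pi this is [sin x - x * cos x] at [x = c + y], up to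
sign.  Its derivative [(c + y) * sin y] is positive for [c >= 0] and
[0 < y < pi]. *)
Definition tan_gap c y : R := sin y - (c + y) * cos y.

Lemma is_derive_tan_gap c y : is_derive y 1 (tan_gap c) ((c + y) * sin y).
Proof.
rewrite (_ : tan_gap c = sin - (cst c + id) * cos)%R; last by apply/funext.
apply: is_derive_eq.
by rewrite -[LHS]/(cos y - ((c + y) * - sin y + cos y * (0 + 1))); ring.
Qed.

Lemma tan_gap_lt c x y : 0 <= c -> 0 <= x -> x < y -> y <= pi ->
  tan_gap c x < tan_gap c y.
Proof.
move=> c0 x0 xy ypi.
have [|z zxy e] := MVT xy (fun z _ => is_derive_tan_gap c z).
  apply: continuous_subspaceT => z; apply: differentiable_continuous.
  by apply/derivable1_diffP; have [] := is_derive_tan_gap c z.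
rewrite -subr_gt0 e; move: zxy; rewrite in_itv /= => /andP[xz zy].
rewrite mulr_gt0 ?subr_gt0 // mulr_gt0 ?sin_gt0_pi //.
- by rewrite ltr_wpDl // (le_lt_trans x0).
- by rewrite (le_lt_trans x0 xz) (lt_le_trans zy).
Qed.

(** The values at the endpoints are [- c] and [c + pi]. *)
Lemma tan_gap_root c : 0 < c -> exists2 y, 0 < y < pi & tan_gap c y = 0.
Proof.
move=> c0.
have g0 : tan_gap c 0 = - c by rewrite /tan_gap sin0 cos0 addr0 mulr1 sub0r.
have gpi : tan_gap c pi = c + pi by rewrite /tan_gap sinpi cospi; ring.
have pi0 := pi_gt0 R.
have [||y] := @IVT R (tan_gap c) 0 pi 0 (pi_ge0 R).
- apply: continuous_subspaceT => z; apply: differentiable_continuous.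
  by apply/derivable1_diffP; have [] := is_derive_tan_gap c z.
- rewrite g0 gpi ge_min le_max.
  by apply/andP; split; apply/orP; [left|right]; lra.
rewrite in_itv /= => /andP[y0 ypi] gy; exists y => //.
rewrite !lt_neqAle y0 ypi !andbT; apply/andP; split; apply/eqP => e.
  by move: gy; rewrite -e g0; lra.
by move: gy; rewrite e gpi; lra.
Qed.

Lemma sin_add_mulpi m y : sin (pi * m%:R + y) = (-1) ^+ m * sin y.
Proof. by rewrite addrC mulr_natr (alternatingn (@sinDpi R)). Qed.

Lemma cos_add_mulpi m y : cos (pi * m%:R + y) = (-1) ^+ m * cos y.
Proof. by rewrite addrC mulr_natr (alternatingn (@cosDpi R)). Qed.

Lemma tan_rootE m y (x := pi * m%:R + y) :
  (sin x == x * cos x) = (tan_gap (pi * m%:R) y == 0).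
Proof.
rewrite /x sin_add_mulpi cos_add_mulpi mulrCA -subr_eq0 -mulrBr mulf_eq0.
by rewrite signr_eq0.
Qed.

Lemma pos_mulpiD x : 0 < x ->
  exists m y, [/\ x = pi * m%:R + y, 0 <= y & y < pi].
Proof.
move=> x0; have pi0 := pi_gt0 R; have xpi : 0 <= x / pi.
  by rewrite divr_ge0 // ltW.
have /andP[h1 h2] := truncn_itv xpi.
exists (Num.trunc (x / pi)), (x - pi * (Num.trunc (x / pi))%:R); split.
- by rewrite addrC subrK.
- by rewrite subr_ge0 mulrC -ler_pdivlMr.
- by move: h2; rewrite ltr_pdivrMr // -natr1; lra.
Qed.

Definition tan_root_spec m x := [/\ pi * m%:R < x, x < pi * m.+1%:R &
  sin x = x * cos x].

Lemma tan_root_exists m : (0 < m)%N -> exists x, tan_root_spec m x.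
Proof.
move=> m0; have c0 : 0 < pi * m%:R :> R by rewrite mulr_gt0 ?pi_gt0 ?ltr0n.
have [y /andP[y0 ypi] gy] := tan_gap_root c0.
exists (pi * m%:R + y); split; first by rewrite ltrDl.
  by rewrite -natr1 mulrDr mulr1 ltrD2l.
by apply/eqP; rewrite tan_rootE gy.
Qed.

Lemma tan_root_uniq m x x' : tan_root_spec m x -> tan_root_spec m x' -> x = x'.
Proof.
have pm0 : 0 <= pi * m%:R :> R by rewrite mulr_ge0 // pi_ge0.
have le z z' : tan_root_spec m z -> tan_root_spec m z' -> ~ z < z'.
  move=> [a1 a2 /eqP a3] [b1 b2 /eqP b3] zz.
  have e (w : R) : w = pi * m%:R + (w - pi * m%:R) by rewrite addrC subrK.
  have := @tan_gap_lt (pi * m%:R) (z - pi * m%:R) (z' - pi * m%:R) pm0.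
  move: a3 b3; rewrite (e z) (e z') !tan_rootE -!e => /eqP -> /eqP ->.
  rewrite ltxx => /(_ _ _ _)/negP; apply => //.
  - by rewrite subr_ge0 ltW.
  - by rewrite ltrD2r.
  - by move: b2; rewrite -natr1; lra.
move=> hx hx'; have [xx|xx|//] := ltgtP x x'.
  by case: (le _ _ hx hx' xx).
by case: (le _ _ hx' hx xx).
Qed.

Lemma tan_root_ex_spec x : 0 < x -> sin x = x * cos x ->
  exists2 m, (0 < m)%N & tan_root_spec m x.
Proof.
move=> x0 sx; have [m [y [e y0 ypi]]] := pos_mulpiD x0.
have := sx; rewrite e => /eqP; rewrite tan_rootE => /eqP gy.
have y_gt0 : 0 < y.
  rewrite lt_neqAle y0 andbT; apply/eqP => y_0.
  move: gy; rewrite /tan_gap -y_0 sin0 cos0 addr0 mulr1 sub0r => /eqP.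
  by rewrite oppr_eq0 => /eqP h; move: x0; rewrite e h -y_0 addr0 ltxx.
exists m; last first.
  split; [by rewrite ltrDl | by rewrite -natr1 mulrDr mulr1 ltrD2l |].
  by apply/eqP; rewrite tan_rootE gy.
case: m e gy => // e; rewrite mulr0 => gy.
have := @tan_gap_lt 0 0 y (lexx 0) (lexx 0) y_gt0 (ltW ypi).
by rewrite gy /tan_gap sin0 addr0 mul0r subrr ltxx.
Qed.

Lemma sin_eq0_pos x : 0 < x ->
  sin x = 0 <-> exists2 m, (0 < m)%N & x = pi * m%:R.
Proof.
move=> x0; split=> [|[m m0 ->]]; last first.
  by rewrite -[pi * _]addr0 sin_add_mulpi sin0 mulr0.
have [m [y [e y0 ypi]]] := pos_mulpiD x0.
rewrite e sin_add_mulpi => /eqP; rewrite mulf_eq0 signr_eq0 /= => /eqP sy.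
have y_0 : y = 0.
  apply/eqP; rewrite eq_le y0 andbT leNgt; apply/negP => y_gt0.
  by have := @sin_gt0_pi R y; rewrite y_gt0 ypi sy ltxx => /(_ isT).
exists m; last by rewrite y_0 addr0.
by rewrite lt0n; apply/eqP => m0; move: x0; rewrite e y_0 m0 mulr0 addr0 ltxx.
Qed.

(** Clearing the denominator adds no solution: sin and cos have no common zero,
and a zero of cos, where [tan] is 0, is not a positive root of [tan x = x]. *)
Lemma tan_rootsP x : tan_roots x <-> 0 < x /\ sin x = x * cos x.
Proof.
rewrite /tan_roots /= /tan; split=> -[x0 h]; split=> //.
  have c0 : cos x != 0.
    by apply/eqP => c0; move: h x0; rewrite c0 invr0 mulr0 => <-; rewrite ltxx.
  by rewrite -[LHS](divfK c0) h.
have c0 : cos x != 0.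
  apply/eqP => c0; have := cos2Dsin2 x.
  by rewrite h c0 mulr0 expr0n addr0 => /esym/eqP; rewrite oner_eq0.
by rewrite h mulfK.
Qed.

End TangentRoots.

Section Enumeration.
Context {R : realType}.

Lemma nth_ascending_enum (T : set R) (y : R^nat) n :
  (forall k, y k < y k.+1) -> (forall s, T s <-> exists k, s = y k) ->
  nth_ascending T n.+1 (y n).
Proof.
move=> yS yT; have /increasing_seqP ymono := yS.
split => //; first by apply/yT; exists n.
have -> : [set s | T s /\ s < y n] = y @` `I_n.
  apply/seteqP; split=> [s [/yT[k ->]]|_ [k /= kn <-]].
    by rewrite (leW_mono ymono) => kn; exists k.
  by split; [apply/yT; exists k | rewrite (leW_mono ymono)].
by apply: inj_card_eq => j k _ _; exact: (inc_inj ymono).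
Qed.

(** pi, x_1, 2 pi, x_2, and so on: the multiples of pi interlace the roots. *)
Definition interleave (x : R^nat) (k : nat) : R :=
  if odd k then x (k./2).+1 else pi * (k./2).+1%:R.

Lemma interleave_lt (x : R^nat) k :
  (forall m, (0 < m)%N -> tan_root_spec m (x m)) ->
  interleave x k < interleave x k.+1.
Proof.
move=> hx; rewrite /interleave /= uphalf_half.
by case: (odd k) => /=; have [] := hx (k./2).+1 isT.
Qed.

Lemma interleaveP (x : R^nat) s :
  (forall m, (0 < m)%N -> tan_root_spec m (x m)) ->
  (0 < s /\ (sin s = 0 \/ sin s = s * cos s)) <-> exists k, s = interleave x k.
Proof.
move=> hx; split=> [[s0 []]|[k ->]].
- move=> /(sin_eq0_pos s0)[[//|m] _ ->]; exists m.*2.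
  by rewrite /interleave odd_double doubleK.
- move=> /(tan_root_ex_spec s0)[[//|m] _ hm]; exists (m.*2.+1).
  rewrite /interleave /= odd_double /= uphalf_double.
  exact: tan_root_uniq hm (hx _ _).
have pi0 := pi_gt0 R; rewrite /interleave; case: (odd k).
  have [h1 _ h3] := hx (k./2).+1 isT; split; last by right.
  by apply: lt_trans h1; rewrite mulr_gt0.
split; first by rewrite mulr_gt0.
by left; apply/sin_eq0_pos; [rewrite mulr_gt0 | exists (k./2).+1].
Qed.

End Enumeration.

(** * Conjugate times along oscillating geodesics *)

Section ConjugateTimes.
Context {R : realType}.
Implicit Types (i : nat) (a : 'rV[R]_3) (b t x : R).

Lemma sphere2E a :
  sphere2 a <-> a 0 0 ^+ 2 + a 0 1 ^+ 2 + a 0 2 ^+ 2 = 1.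
Proof. by rewrite /sphere2 /= sum3. Qed.

Lemma zetaE i a b t : sphere2 a ->
  zeta i a b t = - (wsq i (a 0 1) b * (t / 2) ^+ 2).
Proof.
move=> /sphere2E sph.
have e0 : a 0 0 ^+ 2 = 1 - a 0 1 ^+ 2 - a 0 2 ^+ 2 by rewrite -sph; ring.
rewrite /zeta /kappa /rot_rate /wsq; set r := if _ then _ else _.
have -> : (a 0 0 * t / 2) ^+ 2 + (a 0 2 * t / 2) ^+ 2 - (r * t / 2) ^+ 2 =
  (a 0 0 ^+ 2 + a 0 2 ^+ 2 - r ^+ 2) * (t / 2) ^+ 2 by field.
by rewrite e0 /r; case: (i == 1%N); ring.
Qed.

Lemma w_gt0 i (a2 b : R) : (0 < w i a2 b) = (0 < wsq i a2 b).
Proof. by rewrite /w sqrtr_gt0. Qed.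

Lemma zeta_oscillating i a b t : sphere2 a -> 0 < w i (a 0 1) b ->
  zeta i a b t = - (w i (a 0 1) b * t / 2) ^+ 2.
Proof.
move=> sph; rewrite w_gt0 => h.
by rewrite zetaE // -[in RHS]mulrA [in RHS]exprMn /w sqr_sqrtr // ltW.
Qed.

Lemma sinhq_eq0 x : 0 < x -> sinhq (- x ^+ 2) = 0 <-> sin x = 0.
Proof.
move=> x0; rewrite -sinhq_sqr; split=> [->|/eqP]; first by rewrite mulr0.
by rewrite mulf_eq0 gt_eqF //= => /eqP.
Qed.

Lemma dsinhq_eq0 x : 0 < x -> dsinhq (- x ^+ 2) = 0 <-> sin x = x * cos x.
Proof.
move=> x0; rewrite -sinhq_sqr -coshq_sqr coshqE.
split=> [->|/(mulfI (lt0r_neq0 x0))/eqP]; first by rewrite mulr0 addr0.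
rewrite eq_sym -subr_eq0 addrAC subrr add0r !mulf_eq0 oppr_eq0 sqrf_eq0.
by rewrite pnatr_eq0 (gt_eqF x0) /= => /eqP.
Qed.

(** Among the three alternatives of [degenerate_iff], the first is excluded; the
zeros of [sinhq] give sin x = 0 and those of [dsinhq] give tan x = x. *)
Lemma conj_times_oscillating i a b t (x := w i (a 0 1) b * t / 2) :
  sphere2 a -> a 0 0 ^+ 2 + a 0 2 ^+ 2 != 0 -> 0 < w i (a 0 1) b ->
  conj_times i a b t <-> 0 < x /\ (sin x = 0 \/ sin x = x * cos x).
Proof.
move=> sph /eqP r0 w0; rewrite /conj_times /=.
have -> : (0 < t) = (0 < x) by rewrite /x -mulrA pmulr_rgt0 // pmulr_lgt0.
split=> -[x0].
  have t0 : 0 < t by move: x0; rewrite /x -mulrA pmulr_rgt0 // pmulr_lgt0.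
  move=> /(degenerate_iff _ _ sph t0); rewrite zeta_oscillating // -/x.
  by case=> [//|/(sinhq_eq0 x0)|/(dsinhq_eq0 x0)]; split=> //; [left|right].
have t0 : 0 < t by move: x0; rewrite /x -mulrA pmulr_rgt0 // pmulr_lgt0.
move=> h; split=> //; apply/(degenerate_iff _ _ sph t0).
rewrite zeta_oscillating // -/x.
case: h => [/(sinhq_eq0 x0)|/(dsinhq_eq0 x0)] h; first by constructor 2.
by constructor 3.
Qed.

Lemma conj_times_nonoscillating i a b t : sphere2 a ->
  a 0 0 ^+ 2 + a 0 2 ^+ 2 != 0 -> wsq i (a 0 1) b <= 0 -> ~ conj_times i a b t.
Proof.
move=> sph /eqP r0 w0 [t0 /(degenerate_iff _ _ sph t0)].
have z0 : 0 <= zeta i a b t.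
  by rewrite zetaE // oppr_ge0 mulr_le0_ge0 // sqr_ge0.
by case=> [//||] /eqP; rewrite gt_eqF // ?sinhq_gt0 ?dsinhq_gt0.
Qed.

Lemma conj_times_enum (x : R^nat) i a b n :
  (forall m, (0 < m)%N -> tan_root_spec m (x m)) ->
  sphere2 a -> a 0 0 ^+ 2 + a 0 2 ^+ 2 != 0 -> 0 < w i (a 0 1) b ->
  nth_ascending (conj_times i a b) n.+1 (2 * interleave x n / w i (a 0 1) b).
Proof.
move=> hx sph r0 w0.
apply: (@nth_ascending_enum _ _ (fun k => 2 * interleave x k / w i (a 0 1) b)).
  by move=> k; rewrite ltr_pM2r ?invr_gt0 // ltr_pM2l // interleave_lt.
move=> s; rewrite conj_times_oscillating // (interleaveP _ hx).
have w1 := lt0r_neq0 w0.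
split=> -[k e]; exists k; first by rewrite -e; field.
by rewrite e; field.
Qed.

Lemma tan_roots_enum (x : R^nat) n :
  (forall m, (0 < m)%N -> tan_root_spec m (x m)) ->
  nth_ascending tan_roots n.+1 (x n.+1).
Proof.
move=> hx; apply: (@nth_ascending_enum _ _ (fun k => x k.+1)).
  move=> k; have [_ h _] := hx k.+1 isT; have [h' _ _] := hx k.+2 isT.
  exact: lt_trans h'.
move=> s; rewrite tan_rootsP; split.
  move=> [s0 /(tan_root_ex_spec s0)[[//|m] _ hm]]; exists m.
  exact: tan_root_uniq hm (hx _ _).
move=> [k ->]; have [h1 _ h3] := hx k.+1 isT; split=> //.
by apply: lt_trans h1; rewrite mulr_gt0 // pi_gt0.
Qed.

End ConjugateTimes.

(** * First conjugate locus *)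

Section FirstConjugateLocus.
Context {R : realType}.
Implicit Types (i : nat) (a : 'rV[R]_3) (b t x : R).

Lemma polar_sphere2 (phi0 a2 : R) :
  -1 < a2 -> a2 < 1 -> sphere2 (polar phi0 a2).
Proof.
move=> h1 h2; apply/sphere2E; rewrite !mxE /= sqrrN !exprMn sqr_sqrtr; last nra.
by rewrite -[cos phi0 ^+ 2](addrK (sin phi0 ^+ 2)) cos2Dsin2; ring.
Qed.

Lemma polar_offaxis (phi0 a2 : R) : -1 < a2 -> a2 < 1 ->
  polar phi0 a2 0 0 ^+ 2 + polar phi0 a2 0 2 ^+ 2 != 0.
Proof.
move=> h1 h2; have /sphere2E := polar_sphere2 phi0 h1 h2.
rewrite {2}/polar !mxE /= => e.
by apply/eqP => e0; move: e; rewrite addrAC; nra.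
Qed.

Lemma first_conj_time_le i a b t : conj_times i a b t ->
  (first_conj_time i a b <= t%:E)%E.
Proof. by move=> h; apply: ereal_inf_lbound; exists t. Qed.

(** Every positive time is conjugate on the axis, so the infimum is 0 and there
is no first conjugate point. *)
Lemma first_conj_time_axis i a b t : sphere2 a ->
  a 0 0 ^+ 2 + a 0 2 ^+ 2 = 0 -> first_conj_time i a b = t%:E -> ~ 0 < t.
Proof.
move=> sph r0 e t0; have t20 : 0 < t / 2 by rewrite divr_gt0.
have : conj_times i a b (t / 2).
  by split=> //; apply/(degenerate_iff _ _ sph t20); constructor 1.
by move=> /first_conj_time_le; rewrite e lee_fin; lra.
Qed.

Lemma first_conj_time_nonoscillating i a b : sphere2 a ->
  a 0 0 ^+ 2 + a 0 2 ^+ 2 != 0 -> wsq i (a 0 1) b <= 0 ->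
  first_conj_time i a b = +oo%E.
Proof.
move=> sph r0 w0; rewrite /first_conj_time.
rewrite (_ : [set _ | _ in _] = set0) ?ereal_inf0 //.
apply/seteqP; split=> // s [t ht _].
exact: (conj_times_nonoscillating sph r0 w0 ht).
Qed.

Lemma first_conj_time_oscillating i a b : sphere2 a ->
  a 0 0 ^+ 2 + a 0 2 ^+ 2 != 0 -> 0 < w i (a 0 1) b ->
  first_conj_time i a b = (2 * pi / w i (a 0 1) b)%:E.
Proof.
move=> sph r0 w0; have pi0 := pi_gt0 R; have w1 := lt0r_neq0 w0.
apply/eqP; rewrite eq_le; apply/andP; split.
  apply: first_conj_time_le; apply/conj_times_oscillating => //.
  have -> : w i (a 0 1) b * (2 * pi / w i (a 0 1) b) / 2 = pi by field.
  by split=> //; left; exact: sinpi.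
apply: le_ereal_inf_tmp => _ [t ht <-]; rewrite lee_fin.
rewrite ler_pdivrMr // mulrC [t * _]mulrC -ler_pdivlMr //.
have [x0 hx] := (conj_times_oscillating t sph r0 w0).1 ht.
case: hx => [/(sin_eq0_pos x0)[m m0 ->]|].
  by rewrite ler_peMr // ?ler1n // ltW.
move=> /(tan_root_ex_spec x0)[m m0 [/ltW h _ _]]; apply: le_trans h.
by rewrite ler_peMr // ?ler1n // ltW.
Qed.

Lemma geodesic_first_conj i a b (t := 2 * pi / w i (a 0 1) b) :
  sphere2 a -> 0 < w i (a 0 1) b ->
  geodesic i a b t =
  su11R_mx (- cos (theta b t) +i* - sin (theta b t)) 0 (a 0 1 * t).
Proof.
move=> sph w0; have w1 := lt0r_neq0 w0.
have zE : zeta i a b t = - pi ^+ 2.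
  by rewrite zeta_oscillating //; congr (- _ ^+ 2); rewrite /t; field.
have s0 : sinhq (zeta i a b t) = 0.
  by rewrite zE; apply/(sinhq_eq0 (pi_gt0 R)); exact: sinpi.
rewrite geodesicE /ReA /ImA /ReB /ImB s0 zE coshq_sqr cospi.
by congr su11R_mx; apply/eqP; rewrite eq_complex /=; apply/andP; split;
  apply/eqP; ring.
Qed.

Lemma circle_angle (x y : R) : x ^+ 2 + y ^+ 2 = 1 ->
  exists psi, x = cos psi /\ y = sin psi.
Proof.
move=> xy; have x1 : -1 <= x <= 1 by apply/andP; split; nra.
have e : Num.sqrt (1 - x ^+ 2) = `|y|.
  by rewrite -sqrtr_sqr; congr Num.sqrt; rewrite -xy; ring.
have [y0|y0] := lerP 0 y.
  by exists (acos x); rewrite acosK // sin_acos // e ger0_norm.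
exists (- acos x); rewrite cosN sinN acosK // sin_acos // e ltr0_norm //.
by rewrite opprK.
Qed.

Lemma norm_complex1 (x y : R) : (`|x +i* y| = 1) <-> (x ^+ 2 + y ^+ 2 = 1).
Proof.
rewrite normc_def /=; split=> [[/(congr1 (fun z => z ^+ 2))]|->].
  by rewrite sqr_sqrtr ?expr1n // addr_ge0 // sqr_ge0.
by rewrite sqrtr1.
Qed.

Lemma first_conj_locus_sub i (M : 'M[R[i]]_3) : first_conj_locus i M ->
  exists psi v, M = su11R_mx (cos psi +i* sin psi) 0 v.
Proof.
move=> [a [b [t [sph tE t0 ->]]]].
have [r0|r0] := eqVneq (a 0 0 ^+ 2 + a 0 2 ^+ 2) 0.
  by case: (first_conj_time_axis sph r0 tE t0).
have [w0|] := leP (wsq i (a 0 1) b) 0.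
  by move: tE; rewrite first_conj_time_nonoscillating.
rewrite -w_gt0 => w0.
move: tE; rewrite first_conj_time_oscillating // => -[<-].
rewrite geodesic_first_conj //.
exists (theta b (2 * pi / w i (a 0 1) b) + pi).
exists (a 0 1 * (2 * pi / w i (a 0 1) b)).
by rewrite cosDpi sinDpi.
Qed.

(** Prescribe the quotients [X = rot_rate / w] and [Y = a2 / w].  At
[t = 2 pi / w] the translation is [v = 2 pi * Y] and the phase is
[th = pi * (X - d)], where [d] is [Y] or 0.  The definition of [w] reads
[w^-2 = X^2 + Y^2 - 1], and [a2^2 < 1] amounts to [X^2 > 1]; the latter can be
achieved because the phase only matters modulo 2 pi. *)
Lemma first_conj_locus_sup i (psi v : R) :
  first_conj_locus i (su11R_mx (cos psi +i* sin psi) 0 v).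
Proof.
have pi0 := pi_gt0 R; have pi1 := lt0r_neq0 pi0.
pose Y := v / (2 * pi); pose d := if i == 1%N then Y else 0.
(* k full turns make X exceed 1. *)
pose k := (Num.trunc `|psi / pi + d|).+1.
pose X := (k.*2.+1)%:R + psi / pi + d.
have X1 : 1 < X.
  have h : `|psi / pi + d| < k%:R by exact: truncnS_gt.
  have k0 : 0 < k%:R :> R by rewrite ltr0n.
  rewrite ltr_norml in h; move/andP: h => [h _].
  by rewrite /X -natr1 -muln2 natrM; lra.
pose q := X ^+ 2 + Y ^+ 2 - 1.
have q0 : 0 < q by rewrite /q; nra.
pose om := (Num.sqrt q)^-1.
have om0 : 0 < om by rewrite invr_gt0 sqrtr_gt0.
have om1 := lt0r_neq0 om0.
have omq : om ^+ 2 * q = 1.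
  by rewrite exprVn sqr_sqrtr ?ltW // mulVf // gt_eqF.
pose a2 := Y * om; pose b := (X - d) * om.
have a21 : a2 ^+ 2 < 1.
  by rewrite -omq /a2 exprMn mulrC ltr_pM2l ?exprn_gt0 // /q; nra.
have /andP[h1 h2] : -1 < a2 < 1.
  by rewrite -ltr_norml -(@expr_lt1 _ 2) // real_normK ?num_real.
have wE : w i a2 b = om.
  rewrite /w (_ : wsq i a2 b = om ^+ 2) ?sqrtr_sqr ?gtr0_norm //.
  transitivity ((X * om) ^+ 2 + a2 ^+ 2 - 1).
    by rewrite /wsq /b /d /a2; case: (i == 1%N); ring.
  by rewrite -[X in _ - X]omq /q /a2; ring.
pose a := polar 0 a2.
have aE : a 0 1 = a2 by rewrite mxE.
have sph : sphere2 a by exact: polar_sphere2.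
have w0 : 0 < w i (a 0 1) b by rewrite aE wE.
exists a, b, (2 * pi / w i (a 0 1) b); split => //.
- by apply: first_conj_time_oscillating => //; exact: polar_offaxis.
- by rewrite divr_gt0 // mulr_gt0.
rewrite geodesic_first_conj // aE wE.
have -> : theta b (2 * pi / om) = pi * (k.*2.+1)%:R + psi.
  have alg (p o K : R) : p != 0 -> o != 0 ->
      (K + psi / p) * o * (2 * p / o) / 2 = p * K + psi.
    by move=> p1 o1; field; rewrite o1.
  by rewrite /theta /b /X addrK alg.
have -> : a2 * (2 * pi / om) = v.
  have alg (p o : R) : p != 0 -> o != 0 -> v / (2 * p) * o * (2 * p / o) = v.
    by move=> p1 o1; field; rewrite o1.
  by rewrite /a2 /Y alg.
rewrite cos_add_mulpi sin_add_mulpi exprS -mul2n exprM sqrrN !expr1n mulr1.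
by rewrite !mulN1r !opprK.
Qed.

End FirstConjugateLocus.

Theorem corollary1 (R : realType) (i : nat) (hi : i = 1%N \/ i = 2%N) :
  (exists x : nat -> R,
     (forall m : nat, (0 < m)%N -> nth_ascending tan_roots m (x m)) /\
     forall phi0 a2 b : R, -1 < a2 -> a2 < 1 -> 0 < w i a2 b ->
       forall m : nat, (0 < m)%N ->
         nth_ascending (conj_times i (polar phi0 a2) b) (2 * m - 1)%N
           (2 * pi * m%:R / w i a2 b) /\
         nth_ascending (conj_times i (polar phi0 a2) b) (2 * m)%N
           (2 * x m / w i a2 b)) /\
  first_conj_locus i =
    [set M : 'M[R[i]]_3 | exists (A B : R[i]) (v : R),
       [/\ SU11R M, M = su11R_mx A B v, `|A| = 1 & B = 0]].
Proof.
split.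
  have [x hx] : {x : nat -> R & forall m, (0 < m)%N -> tan_root_spec m (x m)}.
    apply: (@choice _ _ (fun m y => (0 < m)%N -> tan_root_spec m y)) => m.
    have [m0|/negP m0] := boolP (0 < m)%N; last by exists 0.
    by have [y hy] := tan_root_exists (R := R) m0; exists y.
  exists x; split=> [[//|m] _|phi0 a2 b h1 h2 w0 [//|m] _].
    exact: tan_roots_enum.
  have sph := polar_sphere2 phi0 h1 h2.
  have r0 := polar_offaxis phi0 h1 h2.
  have aE : polar phi0 a2 0 1 = a2 by rewrite mxE.
  have enum n := conj_times_enum (i := i) (b := b) n hx sph r0.
  rewrite aE in enum; split.
    have -> : (2 * m.+1 - 1)%N = (m.*2).+1 by rewrite mul2n doubleS subn1.
    have := enum m.*2 w0.
    by rewrite /interleave odd_double doubleK mulrA.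
  have -> : (2 * m.+1)%N = (m.*2.+1).+1 by rewrite mul2n doubleS.
  have := enum m.*2.+1 w0.
  by rewrite /interleave /= odd_double /= uphalf_double.
apply/seteqP; split=> [M /first_conj_locus_sub[psi [v ->]]|M /=].
  have n1 : `|cos psi +i* sin psi| = 1 by apply/norm_complex1/cos2Dsin2.
  exists (cos psi +i* sin psi), 0, v; split=> //.
  exists (cos psi +i* sin psi), 0, v; split=> //.
  by rewrite n1 normr0 expr0n expr1n subr0.
move=> [[x y] [B [v [_ -> /norm_complex1 xy ->]]]].
have [psi [-> ->]] := circle_angle xy.
exact: first_conj_locus_sup.
Qed.
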